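(* Let $G=(V,E,\omega,\mu)$ be an infinite, locally finite, connected weighted graph with $\omega_{\min}>0$ and $D_\mu<\infty$. Let $T>0$, let $\psi:V\to\mathbb R$ satisfy $\psi\ge0$, $\psi\not\equiv0$, and let $f=f(x,t,u)$ be a real-valued function of $x\in V$, $t\in[0,T]$, $u\in\mathbb R$. Let $\bar u$ and $\underline u$ be a bounded upper solution and a bounded lower solution, respectively, of $$u_t-\Delta u=f(x,t,u),\quad (x,t)\in V\times(0,T],\qquad u(x,0)=\psi(x),\quad x\in V.\qquad(\ast)$$ Put $\underline\eta=\inf_{V\times[0,T]}\min\{\bar u,\underline u\}$ and $\bar\eta=\sup_{V\times[0,T]}\max\{\bar u,\underline u\}$. Assume that $f(x,t,0)=0$ for all $x\in V$, $t\in[0,T]$; that $f(x,\cdot,u)$ is continuous on $[0,T]$ for all $x\in V$ and $u\in[\underline\eta,\bar\eta]$; and that there is a constant $M>0$ with $$|f(x,t,u)-f(x,t,v)|\le M|u-v|\quad\text{for all }(x,t)\in V\times[0,T],\ u,v\in[\underline\eta,\bar\eta].$$ Then $(\ast)$ admits a unique solution $u$ that is continuous on $[0,T]$ and $C^1$ on $(0,T]$ in $t$ for each $x\in V$ and satisfies $\underline u\le u\le\bar u$ on $V\times[0,T]$.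
   Context: Weighted graph: $V$ is the vertex set, $E$ the edge set, $y\sim x$ means $xy\in E$; $\omega:V\times V\to[0,\infty)$ satisfies $\omega_{xy}=\omega_{yx}$ and $\omega_{xy}>0$ iff $x\sim y$; $\mu:V\to(0,\infty)$. Locally finite means every vertex has finitely many neighbours. Graphs have no loops and no multiple edges. $\omega_{\min}=\inf_{x\sim y}\omega_{xy}$, and $$\Delta u(x)=\frac1{\mu(x)}\sum_{y\sim x}\omega_{xy}(u(y)-u(x)),\qquad D_\mu=\sup_{x\in V}\frac{1}{\mu(x)}\sum_{y\sim x}\omega_{xy}.$$ An upper (lower) solution of $(\ast)$ is a function $u:V\times[0,T]\to\mathbb R$, bounded on $V\times(0,T]$, with $u(x,\cdot)$ continuous on $[0,T]$ and $C^1$ on $(0,T]$ for each $x\in V$, such that $u_t-\Delta u\ge(\le)\,f(x,t,u)$ on $V\times(0,T]$ and $u(x,0)\ge(\le)\,\psi(x)$ on $V$. *)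

(* Defs.v *)
From HB Require Import structures.
From mathcomp Require Import all_boot all_order all_algebra.
From mathcomp Require Import all_classical all_reals all_analysis.
Set Implicit Arguments.
Unset Strict Implicit.
Unset Printing Implicit Defensive.
Import Order.TTheory GRing.Theory Num.Theory.
Import numFieldNormedType.Exports.
Local Open Scope classical_set_scope.
Local Open Scope ring_scope.

Record weighted_graph (R : realType) (V : choiceType) := WeightedGraph {
  edge : rel V;
  weight : V -> V -> R;
  vmeas : V -> R;
  edge_irreflexive : irreflexive edge;
  weight_ge0 : forall x y, 0 <= weight x y;
  weight_sym : forall x y, weight x y = weight y x;
  weight_gt0 : forall x y, (0 < weight x y) = edge x y;
  vmeas_gt0 : forall x, 0 < vmeas x
}.

Section Graph.
Variables (R : realType) (V : choiceType) (G : weighted_graph R V).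

Definition nbr (x : V) : set V := [set y | edge G x y].

Definition locally_finite : Prop := forall x, finite_set (nbr x).

Definition connected_graph : Prop :=
  forall x y, exists p : seq V, path (edge G) x p /\ last x p = y.

Definition weight_min : \bar R :=
  ereal_inf [set (weight G z.1 z.2)%:E | z in [set z | edge G z.1 z.2]].

(* A finitely supported sum \sum_(y \in A) is 0 when the support is infinite;
   it is the intended sum over the neighbours when G is locally finite. *)
Definition laplacian (u : V -> R) (x : V) : R :=
  (vmeas G x)^-1 * \sum_(y \in nbr x) (weight G x y * (u y - u x)).

Definition deg_sup : \bar R :=
  ereal_sup (range (fun x =>
    ((vmeas G x)^-1 * \sum_(y \in nbr x) weight G x y)%:E)).

End Graph.

(* Derivative relative to a set A: the difference quotients at t are taken
   along s in A, s <> t.  For A = `]0, T] this is the usual derivative at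
   t < T and the left derivative at t = T. *)
Section DeriveIn.
Variable R : realType.
Implicit Types (A : set R) (g : R -> R) (t : R).

Definition diff_quotient g t : R -> R := fun s => (g s - g t) / (s - t).

Definition derivable_in A g t : Prop :=
  cvg (diff_quotient g t s @[s --> within A t^']).

Definition derive_in A g t : R :=
  lim (diff_quotient g t s @[s --> within A t^']).

Definition C1_on A g : Prop :=
  (forall t, A t -> derivable_in A g t) /\
  {within A, continuous (derive_in A g)}.

End DeriveIn.

(* Functions on V x [0, T] are represented by total functions V -> R -> R;
   only their values at times in [0, T] are ever used. *)
Section Problem.
Variables (R : realType) (V : choiceType) (G : weighted_graph R V) (T : R).
Variables (f : V -> R -> R -> R) (psi : V -> R).
Implicit Types u v : V -> R -> R.

Definition time_derive u (x : V) (t : R) : R := derive_in `]0, T] (u x) t.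

Definition bounded_over (I : set R) u : Prop :=
  [bounded (u z.1 z.2 : R^o) | z in [set: V] `*` I].

Definition time_regular u : Prop := forall x,
  {within `[0, T], continuous (u x)} /\ C1_on `]0, T] (u x).

Definition upper_solution u : Prop :=
  [/\ bounded_over `]0, T] u,
      time_regular u,
      (forall x t, t \in `]0, T] ->
         f x t (u x t) <= time_derive u x t - laplacian G (u^~ t) x) &
      (forall x, psi x <= u x 0)].

Definition lower_solution u : Prop :=
  [/\ bounded_over `]0, T] u,
      time_regular u,
      (forall x t, t \in `]0, T] ->
         time_derive u x t - laplacian G (u^~ t) x <= f x t (u x t)) &
      (forall x, u x 0 <= psi x)].

Definition is_solution u : Prop :=
  [/\ time_regular u,
      (forall x t, t \in `]0, T] ->
         time_derive u x t - laplacian G (u^~ t) x = f x t (u x t)) &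
      (forall x, u x 0 = psi x)].

Definition eta_low u v : R :=
  inf [set Num.min (u z.1 z.2) (v z.1 z.2) | z in [set: V] `*` `[0, T]].

Definition eta_up u v : R :=
  sup [set Num.max (u z.1 z.2) (v z.1 z.2) | z in [set: V] `*` `[0, T]].

End Problem.

(* Main.v *)
(* Extend f outside the order interval [eta_low, eta_up] by truncation of its
   last argument, which makes it Lipschitz. Since the Laplacian is bounded by
   2 D_mu in the sup norm, the integral form of the equation is a contraction
   for the sup of exp(-2 L t) |u|, L = 2 D_mu + M, and Picard iteration from
   the lower solution converges. A comparison principle, in which no maximum
   has to be attained (a bound p - q <= S exp(l t) on all of V improves itself
   to S/2 exp(l t)), puts the solution between the lower and the upper one,
   where the truncation is invisible, and gives uniqueness. *)

Require Import Defs.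
From HB Require Import structures.
From mathcomp Require Import all_boot all_order all_algebra.
From mathcomp Require Import all_classical all_reals all_analysis.
From mathcomp Require Import ring lra.
Set Implicit Arguments.
Unset Strict Implicit.
Unset Printing Implicit Defensive.
Import Order.TTheory GRing.Theory Num.Theory.
Import numFieldNormedType.Exports.
Local Open Scope classical_set_scope.
Local Open Scope ring_scope.

(** * Truncation and geometric bounds *)

Section ClampAndHalving.
Context {R : realType}.
Implicit Types (a b c t x y T : R) (g h : R -> R).

(** Truncates the last argument of [f], and also time, where it extends functions from [[0, T]] to
    the whole line. *)
Definition clamp a b x : R := Num.max a (Num.min x b).

Lemma clamp_itv a b x : a <= b -> clamp a b x \in `[a, b].
Proof.
by move=> ab; rewrite in_itv/= le_max lexx ge_max ab ge_min lexx orbT.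
Qed.

Lemma clamp_id a b x : x \in `[a, b] -> clamp a b x = x.
Proof. by rewrite in_itv/= => /andP[ax xb]; rewrite /clamp min_l// max_r. Qed.

Lemma clamp_lipschitz a b x y : `|clamp a b x - clamp a b y| <= `|x - y|.
Proof.
by rewrite /clamp /Num.min /Num.max; repeat case: ifPn;
  rewrite ?subrr ?normr_ge0// -?leNgt => *;
  rewrite ler_norml; have := ler_norm (x - y); have := ler_norm (y - x);
  rewrite distrC => *; apply/andP; split; lra.
Qed.

Lemma continuous_clamp a b : continuous (clamp a b).
Proof.
move=> x; apply/cvgrPdist_le => e e0; near=> y.
by apply: (le_trans (clamp_lipschitz a b x y)); near: y; exact: cvgr_dist_le.
Unshelve. all: by end_near. Qed.

(** Trades continuity on the closed interval for continuity on the line, where endpoints need no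
    separate care. *)
Lemma continuous_comp_clamp a b g : a <= b ->
  {within `[a, b], continuous g} -> continuous (g \o clamp a b).
Proof.
move=> ab /subspace_continuousP cg x.
apply: (cvg_comp (clamp a b) g _ (cg _ (clamp_itv x ab))) => A /= wA.
have /(_ _ wA) := (@continuous_clamp a b x).
by rewrite nbhs_simpl/=; apply: filterS => y; apply; exact: clamp_itv.
Qed.

Lemma le0_half_expr a c : (forall n, a <= c * 2^-1 ^+ n) -> a <= 0.
Proof.
move=> ac; have h : (c * 2^-1 ^+ n) @[n --> \oo] --> (c * 0 : R).
  by apply: cvgMr; apply: cvg_expr; rewrite ger0_norm ?invr_ge0// invf_lt1 ?ltr1n.
rewrite mulr0 in h; rewrite -(cvg_lim _ h)//.
by apply: limr_ge; [exact: cvgP h | near=> n].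
Unshelve. all: by end_near. Qed.

(* The limit is squeezed between the nondecreasing sequence s n - 2c/2^n and
   the nonincreasing sequence s n + 2c/2^n. *)
Lemma half_expr_cauchy (s : nat -> R) c :
  (forall n, `|s n.+1 - s n| <= c * 2^-1 ^+ n) ->
  exists l, forall n, `|s n - l| <= 2 * c * 2^-1 ^+ n.
Proof.
move=> hs; pose d n := 2 * c * 2^-1 ^+ n.
have dS n : d n - d n.+1 = c * 2^-1 ^+ n.
  by rewrite /d exprS; field.
have lo : {homo (fun n => s n - d n) : m n / (m <= n)%N >-> m <= n}.
  apply: homo_leq => [//|? ? ?|n]; first exact: le_trans.
  by have := hs n; rewrite -dS ler_norml => /andP[? ?]; lra.
have up : {homo (fun n => - (s n + d n)) : m n / (m <= n)%N >-> m <= n}.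
  apply: homo_leq => [//|? ? ?|n]; first exact: le_trans.
  by have := hs n; rewrite -dS ler_norml => /andP[? ?]; lra.
have d0 n : 0 <= d n.
  rewrite /d -mulrA mulr_ge0//; exact: le_trans (normr_ge0 _) (hs n).
have lu m n : s m - d m <= s n + d n.
  have [/lo|/ltnW/up] := leqP m n; first by have := d0 n; lra.
  by have := d0 m; lra.
exists (sup (range (fun n => s n - d n))) => n; rewrite -/(d n).
have : s n - d n <= sup (range (fun n => s n - d n)).
  apply: ub_le_sup; last by exists n.
  by exists (s n + d n) => _ [m _ <-]; exact: lu.
have : sup (range (fun n => s n - d n)) <= s n + d n.
  by apply: ge_sup; [exists (s n - d n), n | move=> _ [m _ <-]; exact: lu].
by rewrite ler_norml => *; apply/andP; split; lra.
Qed.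

(** The bound does not depend on t, so convergence is uniform and e splits into three thirds. *)
Lemma half_expr_limit_continuous (s : nat -> R -> R) (g : R -> R) (c : R) :
  (forall n, continuous (s n)) ->
  (forall n t, `|s n t - g t| <= c * 2^-1 ^+ n) -> continuous g.
Proof.
move=> cs sg t; apply/cvgrPdist_le => e e0.
have [n ne] : exists n, c * 2^-1 ^+ n < e / 3.
  apply/not_existsP => h; have e3 : 0 < e / 3 by rewrite divr_gt0.
  suff : e / 3 <= 0 by rewrite leNgt e3.
  by apply: (@le0_half_expr (e / 3) c) => n; rewrite leNgt; apply/negP/h.
near=> x.
have : `|s n t - s n x| <= e / 3.
  by near: x; apply: cvgr_dist_le; [exact: cs | rewrite divr_gt0].
have := sg n t; have := sg n x.
by rewrite !ler_norml => /andP[? ?] /andP[? ?] /andP[? ?]; apply/andP; split; lra.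
Unshelve. all: by end_near. Qed.

End ClampAndHalving.

(** * Derivatives relative to a set, and comparison of increments *)

Section Derivative.
Context {R : realType}.
Implicit Types (a b c t x y T : R) (g h : R -> R).

(* The base point -1 makes the primitive differentiable on both sides at 0. *)
Definition primitive g t : R :=
  \int[lebesgue_measure]_(s in `[-1, t]) g s
  - \int[lebesgue_measure]_(s in `[-1, 0]) g s.

Lemma primitive0 g : primitive g 0 = 0.
Proof. by rewrite /primitive subrr. Qed.

Lemma is_derive_primitive g t :
  continuous g -> 0 <= t -> is_derive t 1 (primitive g) (g t).
Proof.
move=> cg t0.
have ig : lebesgue_measure.-integrable `[-1, t + 1] (EFin \o g).
  apply: continuous_compact_integrable; first exact: segment_compact.
  exact: continuous_subspaceT.
have t1 : -1 < t by lra.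
have tt1 : t < t + 1 by lra.
have [dP eP] := continuous_FTC1_closed tt1 ig t1 (cg t).
rewrite -[g t]subr0; apply: is_deriveB.
by apply: DeriveDef; [exact: dP | rewrite -derive1E; exact: eP].
Qed.

(** [g - h] is nonincreasing. Derivatives are asked for on the open interval only: an upper or lower
    solution need have none at 0, and only a left one at T. *)
Lemma le_increment g h dg dh T : 0 <= T ->
  {within `[0, T], continuous g} -> {within `[0, T], continuous h} ->
  (forall t, t \in `]0, T[ -> is_derive t 1 g (dg t)) ->
  (forall t, t \in `]0, T[ -> is_derive t 1 h (dh t)) ->
  (forall t, t \in `]0, T[ -> dg t <= dh t) ->
  forall t, t \in `[0, T] -> g t - g 0 <= h t - h 0.
Proof.
move=> T0 cg ch Dg Dh dgh t tT.
have Dgh s : s \in `]0, T[ -> is_derive s 1 (g - h) (dg s - dh s).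
  by move=> sT; apply: is_deriveB; [exact: Dg|exact: Dh].
suff : g t - h t <= g 0 - h 0 by lra.
change ((g - h) t <= (g - h) 0).
apply: (@ler0_derive1_le_cc _ _ 0 T) => //.
- by move=> s /Dgh [].
- by move=> s sT; rewrite derive1E (@derive_val _ _ _ _ _ _ _ (Dgh s sT)) subr_le0 dgh.
- exact: within_continuousB.
- by rewrite in_itv/= lexx.
- by move: tT; rewrite in_itv/= => /andP[].
Qed.

(** The substitution s = t + h passes between [diff_quotient] and the quotients that define
    [is_derive]. *)
Lemma cvg_diff_quotient g t (l : R) :
  diff_quotient g t s @[s --> t^'] --> l <->
  h^-1 *: ((g \o shift t) (h *: (1 : R)) - g t) @[h --> (0 : R)^'] --> l.
Proof.
have tr (a b : R) : (x + b - a) @[x --> a^'] --> b^'.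
  move=> A; rewrite /dnbhs !nbhs_simpl/= /within/= near_simpl => tA.
  have ca : (x + b - a) @[x --> a] --> b.
    apply/cvgrPdist_lt => e e0; near=> x.
    have -> : b - (x + b - a) = a - x by ring.
    by near: x; exact: cvgr_dist_lt.
  have := ca _ tA; rewrite !nbhs_simpl/=; apply: filterS => x + xa; apply.
  by rewrite -subr_eq0 addrAC addrK subr_eq0.
split => [dg|dg].
  have := cvg_comp _ _ (tr 0 t) dg; apply: cvg_trans; apply: near_eq_cvg.
  near=> x.
  by rewrite /diff_quotient/= subr0 addrK /GRing.scale/= mulr1 mulrC.
have := cvg_comp _ _ (tr t 0) dg; apply: cvg_trans; apply: near_eq_cvg.
near=> x.
by rewrite /diff_quotient/= addr0 /GRing.scale/= mulr1 subrK mulrC.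
Unshelve. all: by end_near. Qed.

(** All s close to an interior point lie in A, so restricting the quotients to A removes nothing in
    the limit. *)
Lemma derivable_in_interior A g t : A^° t -> derivable_in A g t ->
  is_derive t 1 g (derive_in A g t).
Proof.
move=> At dg.
have /cvg_diff_quotient dgt : diff_quotient g t s @[s --> t^'] --> derive_in A g t.
  apply: cvg_trans dg => B.
  rewrite /within/= !nbhs_simpl/= /dnbhs /within/= !near_simpl => AB.
  by apply: filterS2 At AB => s As + st; apply.
apply: DeriveDef; first exact: cvgP dgt.
exact: (cvg_lim _ dgt).
Qed.

(** A limit survives restriction of the filter; properness makes it unique, hence equal to [lim]. *)
Lemma derive_in_is_derive A g h t d : ProperFilter (within A t^') ->
  A t -> {in A, g =1 h} -> is_derive t 1 h d ->
  derivable_in A g t /\ derive_in A g t = d.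
Proof.
move=> PF At gh [dh hd].
have /cvg_diff_quotient dht :
    h0^-1 *: ((h \o shift t) (h0 *: (1 : R)) - h t) @[h0 --> (0 : R)^'] --> d.
  by rewrite -hd; exact: dh.
have dg : diff_quotient g t s @[s --> within A t^'] --> d.
  apply: cvg_trans (cvg_trans (cvg_within_filter _ dht) _) => //.
  apply: near_eq_cvg.
  by near=> s; rewrite /diff_quotient !gh// inE//; near: s; exact: withinT.
split; first exact: cvgP dg.
exact: (cvg_lim _ dg).
Unshelve. all: by end_near. Qed.

(** Points approaching t from the left stay in the interval, also for t = T. *)
Lemma within_oc_dnbhs_proper t T : t \in `]0, T] ->
  ProperFilter (within `]0, T] t^').
Proof.
rewrite in_itv/= => /andP[t0 tT].
split; last exact: within_filter.
rewrite /within/= /dnbhs /within/=.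
move=> /nbhs_ballP[e/= e0 /(_ (t - Num.min (e / 2) (t / 2)))].
have m0 : 0 < Num.min (e / 2) (t / 2) by rewrite lt_min; lra.
apply.
- rewrite /ball/= opprB addrC subrK gtr0_norm// gt_min; lra.
- by rewrite -subr_eq0 addrAC subrr add0r oppr_eq0 gt_eqF.
- have : Num.min (e / 2) (t / 2) <= t / 2 by rewrite ge_min lexx orbT.
  by rewrite in_itv/= => ?; lra.
Qed.

Lemma is_derive_expRM (c t : R) :
  is_derive t 1 (fun s => expR (c * s)) (c * expR (c * t)).
Proof.
have Dc : is_derive t 1 (fun s : R => c * s) c.
  have := is_deriveZ c (is_derive_id t (1 : R)).
  by rewrite /GRing.scale/= mulr1.
have := is_derive1_comp (is_derive_expR (c * t)) Dc.
by rewrite mulrC.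
Qed.

Lemma expR_ge1 (x : R) : 0 <= x -> 1 <= expR x.
Proof. by move=> x0; rewrite -(@expR0 R) ler_expR. Qed.

Lemma is_derive_within_continuous (A : set R) (g dg : R -> R) :
  (forall t, A t -> is_derive t 1 g (dg t)) -> {within A, continuous g}.
Proof.
move=> Dg; apply: continuous_in_subspaceT => t; rewrite inE => /Dg [dgt _].
by apply: differentiable_continuous; apply/derivable1_diffP.
Qed.

Lemma within_continuousM (A : set R) (g h : R -> R) :
  {within A, continuous g} -> {within A, continuous h} ->
  {within A, continuous (fun t => g t * h t)}.
Proof.
move=> /subspace_continuousP cg /subspace_continuousP ch.
apply/subspace_continuousP => t At.
by apply: cvgM; [exact: cg|exact: ch].
Qed.

End Derivative.

(** * One-sided and Lipschitz bounds for the Laplacian *)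

Section Graph.
Context {R : realType} {V : choiceType} (G : weighted_graph R V).
Hypothesis Glf : locally_finite G.
Implicit Types (u v w : V -> R) (x y : V).

Definition degree x : R :=
  (vmeas G x)^-1 * \sum_(y \in nbr G x) weight G x y.

Lemma degree_ge0 x : 0 <= degree x.
Proof.
rewrite /degree fsbig_finite; last exact: Glf.
rewrite mulr_ge0 ?invr_ge0 ?(ltW (vmeas_gt0 _ _))// sumr_ge0// => y _.
exact: weight_ge0.
Qed.

Lemma degree_bounded : (deg_sup G < +oo)%E ->
  exists2 D, 0 <= D & forall x, degree x <= D.
Proof.
(* The absolute value gives a nonnegative bound before any vertex is at hand; a vertex x then
   excludes the value -oo. *)
move=> h; exists `|fine (deg_sup G)| => // x; apply: le_trans (ler_norm _).
have dx : ((degree x)%:E <= deg_sup G)%E by apply: ereal_sup_ubound; exists x.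
rewrite -lee_fin fineK// fin_numE; apply/andP; split; last by rewrite lt_eqF.
by rewrite gt_eqF// (lt_le_trans _ dx)// ltNyr.
Qed.

(** Each difference [w y - w x] is at most [b - w x] and the weights are nonnegative. The bound b
    need not be attained, so this replaces evaluation at a maximum point. *)
Lemma laplacian_le w x b : (forall y, w y <= b) ->
  laplacian G w x <= degree x * (b - w x).
Proof.
move=> wb; rewrite /degree /laplacian !fsbig_finite; try exact: Glf.
rewrite -mulrA ler_wpM2l ?invr_ge0 ?(ltW (vmeas_gt0 _ _))// mulr_suml.
by apply: ler_sum => y _; rewrite ler_wpM2l ?weight_ge0// lerB.
Qed.

Lemma laplacianB u v x :
  laplacian G (fun y => u y - v y) x = laplacian G u x - laplacian G v x.
Proof.
rewrite /laplacian !fsbig_finite; try exact: Glf.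
rewrite -mulrBr -sumrB; congr (_ * _); apply: eq_bigr => y _; ring.
Qed.

(** Apply the one-sided bound to [u - v] with b = e, where [e - (u x - v x)] is at most 2 e, then
    exchange u and v. *)
Lemma laplacian_lipschitz (D e : R) u v x : (forall x, degree x <= D) ->
  (forall y, `|u y - v y| <= e) ->
  `|laplacian G u x - laplacian G v x| <= 2 * D * e.
Proof.
move=> dD uv.
have e0 : 0 <= e by exact: le_trans (normr_ge0 _) (uv x).
have dist (a b : V -> R) : (forall y, `|a y - b y| <= e) ->
    laplacian G a x - laplacian G b x <= 2 * D * e.
  move=> ab; rewrite -laplacianB.
  have abe y : a y - b y <= e by apply: le_trans (ler_norm _) (ab y).
  apply: le_trans (@laplacian_le (fun y => a y - b y) x e abe) _.
  have := ab x; rewrite ler_norml => /andP[? _].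
  have -> : 2 * D * e = D * (2 * e) by ring.
  by apply: ler_pM (degree_ge0 x) _ (dD x) _; have := abe x; lra.
rewrite ler_norml lerNl opprB !dist// => y; by rewrite distrC.
Qed.

Lemma laplacian_continuous (u : V -> R -> R) x :
  (forall y, continuous (u y)) -> continuous (fun t => laplacian G (u^~ t) x).
Proof.
move=> cu.
have csum (s : seq V) :
    continuous (fun t => \sum_(y <- s) weight G x y * (u y t - u x t)).
  elim: s => [|y s IH].
    by under eq_fun do rewrite big_nil; exact: cst_continuous.
  under eq_fun do rewrite big_cons.
  move=> t; apply: cvgD; last exact: IH.
  by apply: cvgMr; apply: cvgB; exact: cu.
rewrite /laplacian; under eq_fun do rewrite fsbig_finite//.
by move=> t; apply: cvgMr; exact: csum.
Qed.

End Graph.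

(** * The comparison principle *)

Lemma absorb_diagonal (R : realType) (D M d w b L r y : R) :
  0 <= M -> 0 <= d -> d <= D -> w <= b -> 0 <= b ->
  L <= d * (b - w) -> `|r| <= M * `|w| -> y <= L + r ->
  (D + M) * w + y <= (D + 2 * M) * b.
Proof.
move=> M0 d0 dD wb b0 Lb; rewrite ler_norml => /andP[_ rw] yLr.
(* For w >= 0 its total coefficient D - d + 2 M is nonnegative, so w may be replaced by b. For w < 0
   the terms in M cancel and (D - d) w is at most 0. *)
have [w0|w0] := leP 0 w.
  rewrite ger0_norm// in rw.
  have : 0 <= (D - d + 2 * M) * (b - w) by apply: mulr_ge0; lra.
  lra.
rewrite ltr0_norm// in rw.
have : 0 <= (D - d) * - w by apply: mulr_ge0; lra.
have : 0 <= (D - d + 2 * M) * b by apply: mulr_ge0 => //; lra.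
lra.
Qed.

Section Comparison.
Context {R : realType} {V : choiceType} (G : weighted_graph R V).
Hypothesis Glf : locally_finite G.
Variables (T M D : R) (F : V -> R -> R -> R) (p q dp dq : V -> R -> R).
Hypotheses (T0 : 0 <= T) (M0 : 0 <= M) (D0 : 0 <= D).
Hypothesis degD : forall x, degree G x <= D.
Hypothesis cp : forall x, {within `[0, T], continuous (p x)}.
Hypothesis cq : forall x, {within `[0, T], continuous (q x)}.
Hypothesis Dp : forall x t, t \in `]0, T[ -> is_derive t 1 (p x) (dp x t).
Hypothesis Dq : forall x t, t \in `]0, T[ -> is_derive t 1 (q x) (dq x t).
Hypothesis lip : forall x t, t \in `]0, T[ ->
  `|F x t (p x t) - F x t (q x t)| <= M * `|p x t - q x t|.
Hypothesis sub : forall x t, t \in `]0, T[ ->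
  dp x t - laplacian G (p^~ t) x <= F x t (p x t).
Hypothesis super : forall x t, t \in `]0, T[ ->
  F x t (q x t) <= dq x t - laplacian G (q^~ t) x.
Hypothesis init : forall x, p x 0 <= q x 0.

(* The integrating factor exp((D + M) t) gives p - q a coefficient D + M -
   degree x >= M, so that p - q may be replaced by its upper bound; D + 3 M is
   the exponent for which the resulting factor is exactly 1/2. *)
Lemma comparison_contraction (S : R) : 0 <= S ->
  (forall x t, t \in `[0, T] -> p x t - q x t <= S * expR ((D + 3 * M) * t)) ->
  forall x t, t \in `[0, T] ->
    p x t - q x t <= S / 2 * expR ((D + 3 * M) * t).
Proof.
move=> S0 hS x t tT.
pose k := D + M; pose w (s : R) : R := p x s - q x s.
have expD s : expR ((D + 3 * M) * s) * expR (k * s) = expR (2 * (D + 2 * M) * s).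
  by rewrite -expRD; congr expR; rewrite /k; ring.
pose g (s : R) : R := w s * expR (k * s).
pose dg (s : R) : R := w s * (k * expR (k * s)) + (dp x s - dq x s) * expR (k * s).
(* The two exponents D + 3 M and D + M add up to 2 (D + 2 M), so integrating the bound (D + 2 M) S
   exp(2 (D + 2 M) s) leaves S / 2 in front. *)
pose h (s : R) : R := S / 2 * expR (2 * (D + 2 * M) * s).
pose dh (s : R) : R := S / 2 * (2 * (D + 2 * M) * expR (2 * (D + 2 * M) * s)).
have Dg s : s \in `]0, T[ -> is_derive s 1 g (dg s).
  move=> sT; have := is_deriveM (is_deriveB (Dp x sT) (Dq x sT)) (is_derive_expRM k s).
  by rewrite /dg /GRing.scale/= [_ * (dp x s - _)]mulrC.
have Dh (s : R) : is_derive s 1 h (dh s) by exact: is_deriveZ (is_derive_expRM _ _).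
have cg : {within `[0, T], continuous g}.
  have cw : {within `[0, T], continuous w} by exact: within_continuousB.
  have ce : {within `[0, T], continuous (fun s => expR (k * s))}.
    exact: (is_derive_within_continuous (fun s _ => is_derive_expRM k s)).
  exact: within_continuousM cw ce.
have ch : {within `[0, T], continuous h}.
  exact: (is_derive_within_continuous (fun s _ => Dh s)).
have dgh (s : R) : s \in `]0, T[ -> dg s <= dh s.
  move=> sT.
  have sT' : s \in `[0, T] by exact: subset_itv_oo_cc sT.
  have wS : w s <= S * expR ((D + 3 * M) * s) by exact: hS.
  set b := S * _ in wS.
  have b0 : 0 <= b by rewrite mulr_ge0// expR_ge0.
  have -> : dh s = (D + 2 * M) * b * expR (k * s).
    by rewrite /dh /b -expD; field.
  have -> : dg s = (k * w s + (dp x s - dq x s)) * expR (k * s) by rewrite /dg; ring.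
  rewrite ler_pM2r ?expR_gt0//.
  have lap : laplacian G (p^~ s) x - laplacian G (q^~ s) x <= degree G x * (b - w s).
    by rewrite -laplacianB//; apply: laplacian_le => // y; exact: hS.
  (* Here y is [dp x s - dq x s], L the difference of the Laplacians and r that of the values of
     [F]. *)
  apply: (absorb_diagonal M0 (degree_ge0 Glf x) (degD x) wS b0 lap (lip x sT)).
  by have := sub x sT; have := super x sT; lra.
have := le_increment T0 cg ch Dg (fun s _ => Dh s) dgh tT.
rewrite /g /h /w !mulr0 !expR0 -expD => gh.
(* The initial value of g is at most 0 and that of h is S / 2 >= 0, so both drop out; then the
   integrating factor is cancelled. *)
rewrite -(ler_pM2r (expR_gt0 (k * t))).
have := init x; nra.
Qed.

(** Starting from S = [|B|], which is nonnegative, each contraction halves the constant, and the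
    bound tends to 0. *)
Lemma comparison_principle B :
  (forall x t, t \in `[0, T] -> p x t - q x t <= B) ->
  forall x t, t \in `[0, T] -> p x t <= q x t.
Proof.
move=> hB x t tT; rewrite -subr_le0.
apply: (@le0_half_expr _ _ (`|B| * expR ((D + 3 * M) * t))) => n.
rewrite mulrAC; elim: n x t tT => [|n IH] x t tT.
  rewrite expr0 mulr1 (le_trans (hB x t tT))//.
  rewrite (le_trans (ler_norm _))// ler_peMr//.
  move: tT; rewrite in_itv/= => /andP[t0 _].
  by apply/expR_ge1/mulr_ge0; rewrite // addr_ge0// mulr_ge0.
rewrite exprSr [`|B| * _]mulrA.
by apply: comparison_contraction => //; rewrite mulr_ge0// exprn_ge0// invr_ge0.
Qed.

End Comparison.

(** * Picard iteration in an exponentially weighted sup norm *)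

Section Picard.
Context {R : realType} {V : Type}.
Variables (T L : R) (psi : V -> R) (F : V -> R -> (V -> R) -> R).
Implicit Types u v : V -> R -> R.
Hypotheses (T0 : 0 <= T) (L0 : 0 < L).
Hypothesis F_lip : forall x t (a b : V -> R) (e : R), t \in `[0, T] ->
  (forall y, `|a y - b y| <= e) -> `|F x t a - F x t b| <= L * e.
Hypothesis F_cont : forall x u, (forall y, continuous (u y)) ->
  continuous (fun t => F x (clamp 0 T t) (u^~ (clamp 0 T t))).

(** Clamping time in the integrand makes it continuous on the line, so there is a two-sided
    derivative even at 0 and T. [picard] clamps the result too, so that it can be iterated among
    functions continuous on the line. *)
Definition volterra u x t : R :=
  psi x + primitive (fun s => F x (clamp 0 T s) (u^~ (clamp 0 T s))) t.

Definition picard u x t : R := volterra u x (clamp 0 T t).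

Lemma itv_cc0 : 0 \in `[0, T].
Proof. by rewrite in_itv/= lexx. Qed.

Lemma volterra0 u x : volterra u x 0 = psi x.
Proof. by rewrite /volterra primitive0 addr0. Qed.

Lemma is_derive_volterra u x t : (forall y, continuous (u y)) ->
  t \in `[0, T] -> is_derive t 1 (volterra u x) (F x t (u^~ t)).
Proof.
move=> cu tT.
have t0 : 0 <= t by move: tT; rewrite in_itv/= => /andP[].
have := is_deriveD (is_derive_cst (psi x) t 1) (is_derive_primitive (@F_cont x u cu) t0).
by rewrite add0r clamp_id.
Qed.

Lemma volterra_continuous u x : (forall y, continuous (u y)) ->
  {within `[0, T], continuous (volterra u x)}.
Proof.
by move=> cu; apply: is_derive_within_continuous => t; exact: is_derive_volterra.
Qed.

Lemma picard_continuous u x : (forall y, continuous (u y)) ->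
  continuous (picard u x).
Proof. by move=> cu; apply: continuous_comp_clamp => //; exact: volterra_continuous. Qed.

(** The derivative of c / 2 exp(2 L t) is L c exp(2 L t), which dominates the difference of the
    integrands; increments are compared instead of integrals. *)
Lemma picard_contraction u v (c : R) :
  (forall y, continuous (u y)) -> (forall y, continuous (v y)) -> 0 <= c ->
  (forall y t, t \in `[0, T] -> `|u y t - v y t| <= c * expR (2 * L * t)) ->
  forall x t, t \in `[0, T] ->
    `|picard u x t - picard v x t| <= c / 2 * expR (2 * L * t).
Proof.
move=> + + c0 + x t tT.
have half (p q : V -> R -> R) : (forall y, continuous (p y)) ->
    (forall y, continuous (q y)) ->
    (forall y t, t \in `[0, T] -> `|p y t - q y t| <= c * expR (2 * L * t)) ->
    volterra p x t - volterra q x t <= c / 2 * expR (2 * L * t).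
  move=> cp cq pq.
  pose h (s : R) : R := volterra q x s + c / 2 * expR (2 * L * s).
  pose dh (s : R) : R := F x s (q^~ s) + c / 2 * (2 * L * expR (2 * L * s)).
  have Dh s : s \in `[0, T] -> is_derive s 1 h (dh s).
    move=> sT.
    exact: is_deriveD (is_derive_volterra x cq sT) (is_deriveZ _ (is_derive_expRM _ _)).
  have ch : {within `[0, T], continuous h} := is_derive_within_continuous Dh.
  have Dp s : s \in `]0, T[ -> is_derive s 1 (volterra p x) (F x s (p^~ s)).
    by move=> /subset_itv_oo_cc; exact: is_derive_volterra.
  have Dh' s : s \in `]0, T[ -> is_derive s 1 h (dh s).
    by move=> /subset_itv_oo_cc; exact: Dh.
  have le_dh s : s \in `]0, T[ -> F x s (p^~ s) <= dh s.
    move=> /subset_itv_oo_cc sT.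
    have := F_lip x sT (fun y => pq y s sT); rewrite /dh ler_norml => /andP[_ ?].
    have -> : c / 2 * (2 * L * expR (2 * L * s)) = L * (c * expR (2 * L * s)) by field.
    lra.
  have := le_increment T0 (@volterra_continuous p x cp) ch Dp Dh' le_dh tT.
  rewrite /h !volterra0 mulr0 expR0; lra.
move=> cu cv uv; rewrite /picard clamp_id// ler_norml lerNl opprB !half// => y s sT.
by rewrite distrC uv.
Qed.

(** Only the first step has to be bounded, not [u0] itself: later steps shrink by halves, uniformly
    in x and t. *)
Lemma picard_fixpoint u0 (c : R) : (forall y, continuous (u0 y)) ->
  (forall x t, t \in `[0, T] -> `|picard u0 x t - u0 x t| <= c) ->
  exists2 u, forall y, continuous (u y) &
    (forall x t, t \in `[0, T] -> picard u x t = u x t) /\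
    (exists b, forall x t, t \in `[0, T] -> `|u0 x t - u x t| <= b).
Proof.
move=> cu0 hc.
pose un n := iter n picard u0; pose E t : R := expR (2 * L * t).
have E1 t : t \in `[0, T] -> 1 <= E t.
  by rewrite in_itv/= => /andP[t0 _]; apply: expR_ge1; apply/mulr_ge0/t0/mulr_ge0/ltW.
have ET t : t \in `[0, T] -> E t <= E T.
  by rewrite in_itv/= => /andP[_ tT]; rewrite /E ler_expR ler_wpM2l//; exact/mulr_ge0/ltW.
have cun n y : continuous (un n y).
  by elim: n y => [//|n IH] y; exact: picard_continuous.
have step n x t : t \in `[0, T] -> `|un n.+1 x t - un n x t| <= c * 2^-1 ^+ n * E t.
  elim: n x t => [|n IH] x t tT.
    have := hc x t tT; have := E1 t tT; rewrite expr0 mulr1.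
    by move=> ? h; apply: (le_trans h); rewrite ler_peMr// (le_trans _ h).
  rewrite exprSr mulrA; apply: picard_contraction => //.
  - exact: (cun n.+1).
  - by rewrite mulr_ge0 ?exprn_ge0 ?invr_ge0//; exact: le_trans (hc x t tT).
(* The limits are built pointwise; outside [[0, T]] the value 0 is a placeholder. *)
have lim x t : exists l, t \in `[0, T] ->
    forall n, `|un n x t - l| <= 2 * c * 2^-1 ^+ n * E t.
  have [tT|] := boolP (t \in `[0, T]); last by exists 0.
  have [n|l hl] := @half_expr_cauchy R (fun n => un n x t) (c * E t).
    by rewrite mulrAC; exact: step.
  by exists l => _ n; have := hl n; rewrite [2 * _]mulrA mulrAC.
pose l x t := sval (cid (lim x t)).
have hl n x t : t \in `[0, T] -> `|un n x t - l x t| <= 2 * c * 2^-1 ^+ n * E t.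
  by move=> tT; rewrite /l; case: cid => /= z; exact.
(* Clamping discards the placeholder values and makes the limit continuous on the line. *)
pose u x t := l x (clamp 0 T t).
have hu n x t : t \in `[0, T] -> `|un n x t - u x t| <= 2 * c * 2^-1 ^+ n * E t.
  by move=> tT; rewrite /u clamp_id//; exact: hl.
(* The sign of c comes from a distance below it, hence the dependence on a vertex. *)
have c0 (x : V) : 0 <= c by exact: le_trans (hc x 0 itv_cc0).
have c2 (x : V) n : 0 <= 2 * c * 2^-1 ^+ n.
  by rewrite mulr_ge0 ?exprn_ge0 ?invr_ge0// mulr_ge0// c0.
have cu y : continuous (u y).
  apply: (@half_expr_limit_continuous _ (fun n => un n y \o clamp 0 T) _ (2 * c * E T)).
    by move=> n t; apply: continuous_comp; [exact: continuous_clamp|exact: cun].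
  move=> n t /=; have tT := clamp_itv t T0.
  rewrite (le_trans (hl n y _ tT))// mulrAC ler_wpM2r ?exprn_ge0 ?invr_ge0//.
  by rewrite ler_wpM2l ?ET// mulr_ge0// (c0 y).
exists u => //; split; last first.
  exists (2 * c * E T) => x t tT; have := hu 0%N x t tT; rewrite expr0 mulr1.
  by move=> h; rewrite (le_trans h)// ler_wpM2l ?ET// mulr_ge0// (c0 x).
(* Both [picard u] and [u] are close to the iterate n + 1, so their distance is below every 2 c E(t)
   / 2^n. *)
move=> x t tT; apply/eqP; rewrite -subr_eq0 -normr_le0.
apply: (@le0_half_expr _ _ (2 * c * E T)) => n.
have h1 := @picard_contraction _ _ _ (cun n) cu (c2 x n) (hu n) x t tT.
have h2 := hu n.+1 x t tT.
have h3 : `|picard u x t - u x t| <= 2 * c * 2^-1 ^+ n * E t.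
  have -> : 2 * c * 2^-1 ^+ n * E t =
      2 * c * 2^-1 ^+ n / 2 * E t + 2 * c * 2^-1 ^+ n.+1 * E t.
    by rewrite exprSr; field.
  rewrite -[_ - _](subrKA (un n.+1 x t)) (le_trans (ler_normD _ _))// lerD//.
  by rewrite distrC.
rewrite (le_trans h3)// mulrAC ler_wpM2r ?exprn_ge0 ?invr_ge0//.
by rewrite ler_wpM2l ?ET// mulr_ge0// (c0 x).
Qed.

End Picard.

(** * Existence and comparison for a globally Lipschitz nonlinearity *)

Section Evolution.
Context {R : realType} {V : choiceType} (G : weighted_graph R V).
Hypothesis Glf : locally_finite G.
Variables (T M D : R).
Hypotheses (T0 : 0 < T) (M0 : 0 < M) (D0 : 0 <= D).
Hypothesis degD : forall x, degree G x <= D.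
Variable g : V -> R -> R -> R.
Hypothesis g_lip : forall x t a b, t \in `[0, T] ->
  `|g x t a - g x t b| <= M * `|a - b|.
Implicit Types (u p q : V -> R -> R) (x : V) (t : R).

Lemma bounded_overP (I : set R) u : bounded_over I u ->
  exists b, forall x t, I t -> `|u x t| <= b.
Proof.
move=> [b [_ /(_ (b + 1))]]; rewrite ltrDl ltr01 => /(_ isT) ub.
by exists (b + 1) => x t It; exact: (ub (x, t)).
Qed.

Lemma time_derive_interior u x t : time_regular T u -> t \in `]0, T[ ->
  is_derive t 1 (u x) (time_derive T u x t).
Proof.
move=> ru tT; have [_ [du _]] := ru x.
apply: derivable_in_interior; last exact/du/subset_itv_oo_oc.
suff : `]0, T[ `<=` (`]0, T]%classic : set R)^° by exact.
by rewrite -open_subsetE; [exact: subset_itv_oo_oc | exact: interval_open].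
Qed.

Lemma sub_super_le p q (b : R) : time_regular T p -> time_regular T q ->
  (forall x t, t \in `]0, T] ->
     time_derive T p x t - laplacian G (p^~ t) x <= g x t (p x t)) ->
  (forall x t, t \in `]0, T] ->
     g x t (q x t) <= time_derive T q x t - laplacian G (q^~ t) x) ->
  (forall x, p x 0 <= q x 0) ->
  (forall x t, t \in `[0, T] -> p x t - q x t <= b) ->
  forall x t, t \in `[0, T] -> p x t <= q x t.
Proof.
move=> rp rq hp hq pq0 pqb.
apply: (@comparison_principle _ _ _ Glf T M D g p q
  (time_derive T p) (time_derive T q)) pqb => //.
- exact: ltW.
- exact: ltW.
- by move=> x; have [] := rp x.
- by move=> x; have [] := rq x.
- by move=> x t; exact: time_derive_interior.
- by move=> x t; exact: time_derive_interior.
- by move=> x t /subset_itv_oo_cc; exact: g_lip.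
- by move=> x t /subset_itv_oo_oc; exact: hp.
- by move=> x t /subset_itv_oo_oc; exact: hq.
Qed.

Hypothesis g_cont : forall x v, {within `[0, T], continuous (fun t => g x t v)}.

(** As a functional of the whole profile on V, the right-hand side turns the problem into an
    ordinary differential equation with Lipschitz constant 2 D + M in the sup norm. *)
Let F x t (w : V -> R) : R := laplacian G w x + g x t (w x).

Let F_lip x t (a b : V -> R) (e : R) : t \in `[0, T] ->
  (forall y, `|a y - b y| <= e) -> `|F x t a - F x t b| <= (2 * D + M) * e.
Proof.
move=> tT ab; rewrite /F opprD addrACA (le_trans (ler_normD _ _))// mulrDl.
apply: lerD; first exact: laplacian_lipschitz.
by rewrite (le_trans (g_lip _ _ _ tT))// ler_pM2l.
Qed.

(** For the term in [g], freeze its last argument at time t and use continuity in time; the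
    Lipschitz bound pays for unfreezing. *)
Let F_cont x u : (forall y, continuous (u y)) ->
  continuous (fun t => F x (clamp 0 T t) (u^~ (clamp 0 T t))).
Proof.
move=> cu.
have cuc y : continuous (u y \o clamp 0 T).
  by move=> t; apply: continuous_comp; [exact: continuous_clamp|exact: cu].
move=> t; apply: cvgD.
  exact: (@laplacian_continuous _ _ _ Glf (fun y => u y \o clamp 0 T)).
apply/cvgrPdist_le => e e0.
have cg := continuous_comp_clamp (ltW T0) (@g_cont x (u x (clamp 0 T t))).
near=> s.
have h1 : `|g x (clamp 0 T t) (u x (clamp 0 T t))
            - g x (clamp 0 T s) (u x (clamp 0 T t))| <= e / 2.
  by near: s; apply: (@cvgr_dist_le _ _ _ _ _ _ _ (cg t)); rewrite divr_gt0.
have h2 : `|u x (clamp 0 T t) - u x (clamp 0 T s)| <= e / 2 / M.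
  by near: s; apply: (@cvgr_dist_le _ _ _ _ _ _ _ (cuc x t)); rewrite !divr_gt0.
rewrite -(subrKA (g x (clamp 0 T s) (u x (clamp 0 T t)))).
rewrite (le_trans (ler_normD _ _))// [leRHS]splitr lerD//.
rewrite (le_trans (g_lip _ _ _ (clamp_itv _ (ltW T0))))//.
by rewrite mulrC -ler_pdivlMr.
Unshelve. all: by end_near. Qed.

(* The iteration starts at the lower solution rather than at psi: g x t 0 need
   not be bounded in x, but the integral of F along ulow is trapped between
   increments of ulow and of ubar. *)
Lemma lipschitz_solution psi ulow ubar :
  upper_solution G T g psi ubar -> bounded_over `[0, T] ubar ->
  lower_solution G T g psi ulow -> bounded_over `[0, T] ulow ->
  exists2 u, is_solution G T g psi u &
    exists b, forall x t, t \in `[0, T] -> `|ulow x t - u x t| <= b.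
Proof.
move=> [_ rbar supbar ibar] /bounded_overP[b1 hb1].
move=> [_ rlow sublow ilow] /bounded_overP[b2 hb2].
have T0' := ltW T0; have L0 : 0 < 2 * D + M by rewrite ltr_wpDl// mulr_ge0.
set L := 2 * D + M.
pose u0 x t := ulow x (clamp 0 T t).
have cu0 x : continuous (u0 x).
  by have [/(continuous_comp_clamp T0')] := rlow x.
have u0E x t : t \in `[0, T] -> u0 x t = ulow x t by move=> tT; rewrite /u0 clamp_id.
have F0E x t : t \in `[0, T] -> F x t (u0^~ t) = F x t (ulow^~ t).
  by move=> tT; congr F; apply/funext => y; exact: u0E.
have dvol x t : t \in `]0, T[ ->
    is_derive t 1 (volterra T psi F u0 x) (F x t (ulow^~ t)).
  move=> tT; have tT' := subset_itv_oo_cc tT.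
  by rewrite -F0E //; exact: is_derive_volterra.
have cvol x : {within `[0, T], continuous (volterra T psi F u0 x)}.
  exact: volterra_continuous.
(* The constant bounds the first step: b1 + b2 bounds the distance of [ubar] and [ulow], so [F]
   along them differs by at most L (b1 + b2), over a time at most T. *)
have [| u cu [ufix [b hb]]] :=
  @picard_fixpoint _ _ T L psi F T0' L0 F_lip F_cont u0 (b1 + b2 + L * (b1 + b2) * T) cu0.
  move=> x t tT; rewrite u0E// /picard clamp_id//.
  have Dlow s : s \in `]0, T[ -> is_derive s 1 (ulow x) (time_derive T ulow x s).
    exact: time_derive_interior.
  have dlow s : s \in `]0, T[ -> time_derive T ulow x s <= F x s (ulow^~ s).
    by move=> /subset_itv_oo_oc sT; rewrite /F -lerBlDl; exact: sublow.
  have lo := le_increment T0' (proj1 (rlow x)) (cvol x) Dlow (dvol x) dlow tT.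
  pose h (s : R) : R := ubar x s + L * (b1 + b2) * s.
  pose dh (s : R) : R := time_derive T ubar x s + L * (b1 + b2).
  have Dh s : s \in `]0, T[ -> is_derive s 1 h (dh s).
    move=> sT; have := is_deriveZ (L * (b1 + b2)) (is_derive_id s (1 : R)).
    rewrite /GRing.scale/= mulr1; apply: is_deriveD.
    exact: time_derive_interior.
  have ch : {within `[0, T], continuous h}.
    apply: within_continuousD; first exact: proj1 (rbar x).
    by apply: continuous_subspaceT => s; apply: cvgMr; exact: cvg_id.
  have le_dh s : s \in `]0, T[ -> F x s (ulow^~ s) <= dh s.
    move=> sT; have sT' := subset_itv_oo_cc sT.
    have : F x s (ulow^~ s) - F x s (ubar^~ s) <= L * (b1 + b2).
      apply: le_trans (ler_norm _) _; apply: F_lip => // y.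
      by rewrite (le_trans (ler_normB _ _))// addrC lerD ?hb1 ?hb2.
    have := supbar x s (subset_itv_oo_oc sT); rewrite {2}/F /dh; lra.
  have := le_increment T0' (cvol x) ch (dvol x) Dh le_dh tT; rewrite /h => up.
  have := ilow x; have := ibar x.
  have tT' : 0 <= t <= T by move: tT; rewrite in_itv.
  have := hb1 x t tT; have := hb2 x t tT.
  have := hb1 x 0 (itv_cc0 T0'); have := hb2 x 0 (itv_cc0 T0').
  move: lo up; rewrite !volterra0 ler_norml !ler_norml => lo up.
  move=> /andP[? ?] /andP[? ?] /andP[? ?] /andP[? ?] ? ?.
  have b12 : 0 <= L * (b1 + b2) by rewrite mulr_ge0//; [exact: ltW|lra].
  have bt : L * (b1 + b2) * t <= L * (b1 + b2) * T.
    by case/andP: tT' => ? ?; rewrite ler_wpM2l.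
  have bt0 : 0 <= L * (b1 + b2) * t by case/andP: tT' => ? ?; rewrite mulr_ge0.
  by apply/andP; split; lra.
(* Equal to [u] on [[0, T]], but without the outer clamp, so its derivative at T is available. *)
pose U x t := volterra T psi F u x t.
have UE x t : t \in `[0, T] -> U x t = u x t.
  by move=> tT; rewrite -ufix// /picard clamp_id.
have dU x t : t \in `]0, T] ->
    derivable_in `]0, T] (U x) t /\ time_derive T U x t = F x t (u^~ t).
  move=> tT; apply: (@derive_in_is_derive _ _ _ (U x)) => //.
    exact: within_oc_dnbhs_proper.
  exact/is_derive_volterra/subset_itv_oc_cc.
exists U; last by exists b => x t tT; rewrite UE// -u0E//; exact: hb.
split; last by move=> x; exact: volterra0.
- move=> x; split; first exact: volterra_continuous.
  split; first by move=> t /(dU x)[].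
  (* On []0, T]] the derivative is the clamped right-hand side, which is continuous on the line. *)
  apply: (@subspace_eq_continuous _ _ _ (fun t => F x (clamp 0 T t) (u^~ (clamp 0 T t)))).
    move=> t; rewrite inE => tT; have [_ dt] := dU x t tT.
    by rewrite clamp_id; [exact: esym dt | exact: subset_itv_oc_cc].
  by apply: continuous_subspaceT; exact: F_cont.
- move=> x t tT; have [_ ->] := dU x t tT; have tT' := subset_itv_oc_cc tT.
  have -> : U^~ t = u^~ t by apply/funext => y; exact: UE.
  by rewrite UE// /F addrAC subrr add0r.
Qed.

End Evolution.

(** * The order interval and the truncated problem *)

Section EtaRange.
Context {R : realType} {V : choiceType}.
Variables (T : R) (u v : V -> R -> R) (b c : R).
Hypothesis ub : forall x t, t \in `[0, T] -> `|u x t| <= b.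
Hypothesis vc : forall x t, t \in `[0, T] -> `|v x t| <= c.

(** A real infimum or supremum bounds its set only if the set is bounded; b + c bounds both
    functions in absolute value. *)
Lemma eta_bounds x t : t \in `[0, T] ->
  eta_low T u v <= Num.min (u x t) (v x t) /\
  Num.max (u x t) (v x t) <= eta_up T u v.
Proof.
move=> tT; split.
  apply: ge_inf; last by exists (x, t).
  exists (- (b + c)) => _ [[y s] [_ sT] <-] /=.
  have := ub y sT; have := vc y sT; rewrite !ler_norml => /andP[? ?] /andP[? ?].
  by rewrite le_min; apply/andP; split; lra.
apply: ub_le_sup; last by exists (x, t).
exists (b + c) => _ [[y s] [_ sT] <-] /=.
have := ub y sT; have := vc y sT; rewrite !ler_norml => /andP[? ?] /andP[? ?].
by rewrite ge_max; apply/andP; split; lra.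
Qed.

End EtaRange.

Theorem theorem3p2 (R : realType) (V : choiceType) (G : weighted_graph R V)
    (T : R) (psi : V -> R) (f : V -> R -> R -> R) (ubar ulow : V -> R -> R)
    (Vinf : infinite_set [set: V])
    (Glf : locally_finite G)
    (Gconn : connected_graph G)
    (wmin_gt0 : (0 < weight_min G)%E)
    (Dmu_fin : (deg_sup G < +oo)%E)
    (T_gt0 : 0 < T)
    (psi_ge0 : forall x, 0 <= psi x)
    (psi_neq0 : exists x, psi x != 0)
    (ubar_upper : upper_solution G T f psi ubar)
    (ubar_bounded : bounded_over `[0, T] ubar)
    (ulow_lower : lower_solution G T f psi ulow)
    (ulow_bounded : bounded_over `[0, T] ulow)
    (f0 : forall x t, t \in `[0, T] -> f x t 0 = 0)
    (f_cont : forall x v, v \in `[eta_low T ubar ulow, eta_up T ubar ulow] ->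
       {within `[0, T], continuous (fun t => f x t v)})
    (f_lip : exists2 M : R, 0 < M &
       forall x t u v, t \in `[0, T] ->
         u \in `[eta_low T ubar ulow, eta_up T ubar ulow] ->
         v \in `[eta_low T ubar ulow, eta_up T ubar ulow] ->
         `|f x t u - f x t v| <= M * `|u - v|) :
  exists u : V -> R -> R,
    [/\ is_solution G T f psi u,
        (forall x t, t \in `[0, T] -> ulow x t <= u x t <= ubar x t) &
        forall v : V -> R -> R,
          is_solution G T f psi v ->
          (forall x t, t \in `[0, T] -> ulow x t <= v x t <= ubar x t) ->
          forall x t, t \in `[0, T] -> v x t = u x t].
Proof.
have [b1 hb1] := bounded_overP ubar_bounded.
have [b2 hb2] := bounded_overP ulow_bounded.
have [D D0 degD] := degree_bounded Dmu_fin.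
have [M M0 lip] := f_lip.
set lo := eta_low T ubar ulow; set hi := eta_up T ubar ulow.
have eta x t : t \in `[0, T] ->
    [/\ lo <= ubar x t, lo <= ulow x t, ubar x t <= hi & ulow x t <= hi].
  by move=> /(eta_bounds hb1 hb2 x)[]; rewrite le_min ge_max => /andP[? ?] /andP[? ?].
(* Supplies a vertex, at which [lo] and [hi] can be compared. *)
have [x0 _] := psi_neq0.
have lohi : lo <= hi.
  have [h _ h' _] := eta x0 0 (itv_cc0 (ltW T_gt0)); exact: le_trans h h'.
pose g x t v := f x t (clamp lo hi v).
have gE x t v : lo <= v <= hi -> g x t v = f x t v.
  by move=> h; rewrite /g clamp_id// in_itv.
have g_lip x t a b : t \in `[0, T] -> `|g x t a - g x t b| <= M * `|a - b|.
  move=> tT; rewrite (le_trans (lip x t _ _ tT (clamp_itv _ lohi) (clamp_itv _ lohi)))//.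
  by rewrite ler_pM2l// clamp_lipschitz.
have g_cont x v : {within `[0, T], continuous (fun t => g x t v)}.
  exact/f_cont/clamp_itv.
have between v : (forall x t, t \in `[0, T] -> ulow x t <= v x t <= ubar x t) ->
    forall x t, t \in `[0, T] -> lo <= v x t <= hi.
  move=> h x t tT; have [_ ? ? _] := eta x t tT; have /andP[? ?] := h x t tT.
  by apply/andP; split; lra.
(* [ubar] and [ulow] take values between [lo] and [hi], where [g] and [f] agree, so they keep their
   roles for [g]. *)
have gup : upper_solution G T g psi ubar.
  have [? ? sup ?] := ubar_upper; split=> // x t tT.
  by have [? _ ? _] := eta x t (subset_itv_oc_cc tT); rewrite gE ?sup//; apply/andP.
have glow : lower_solution G T g psi ulow.
  have [? ? sub ?] := ulow_lower; split=> // x t tT.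
  by have [_ ? _ ?] := eta x t (subset_itv_oc_cc tT); rewrite gE ?sub//; apply/andP.
have [u su [b hb]] :=
  lipschitz_solution Glf T_gt0 M0 D0 degD g_lip g_cont gup ubar_bounded glow ulow_bounded.
have le_uv := sub_super_le Glf T_gt0 M0 D0 degD g_lip.
have [ru equ u0] := su.
have [_ rbar supbar ibar] := gup; have [_ rlow sublow ilow] := glow.
have range x t : t \in `[0, T] -> ulow x t <= u x t <= ubar x t.
  move=> tT; apply/andP; split.
    apply: (le_uv _ _ b) tT => //.
    - by move=> y s sT; rewrite equ.
    - by move=> y; rewrite u0.
    - by move=> y s sT; rewrite (le_trans (ler_norm _))// hb.
  (* [u - ubar] is split into [u - ulow], [ulow] and [- ubar], bounded by b, b2 and b1. *)
  apply: (le_uv _ _ (b + b2 + b1)) tT => //.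
  - by move=> y s sT; rewrite equ.
  - by move=> y; rewrite u0.
  - move=> y s sT; have := hb y s sT; have := hb1 y s sT; have := hb2 y s sT.
    by rewrite !ler_norml => /andP[? ?] /andP[? ?] /andP[? ?]; lra.
exists u; split => //.
  by split=> // x t tT; rewrite equ// gE// between//; exact: subset_itv_oc_cc.
move=> v [rv eqv v0] rangev x t tT.
(* A competitor between [ulow] and [ubar] also solves the truncated problem, so comparison with [u]
   in both directions gives equality. *)
have eqv' y s : s \in `]0, T] ->
    time_derive T v y s - laplacian G (v^~ s) y = g y s (v y s).
  by move=> sT; rewrite eqv// gE// between//; exact: subset_itv_oc_cc.
have range_diff p q : (forall x t, t \in `[0, T] -> ulow x t <= p x t <= ubar x t) ->
    (forall x t, t \in `[0, T] -> ulow x t <= q x t <= ubar x t) ->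
    forall y s, s \in `[0, T] -> p y s - q y s <= hi - lo.
  move=> hp hq y s sT; have := between p hp y s sT; have := between q hq y s sT.
  by move=> /andP[? ?] /andP[? ?]; lra.
apply/eqP; rewrite eq_le; apply/andP; split.
  apply: (le_uv _ _ (hi - lo)) tT => //; last exact: range_diff.
  - by move=> y s sT; rewrite eqv'.
  - by move=> y s sT; rewrite equ.
  - by move=> y; rewrite u0 v0.
apply: (le_uv _ _ (hi - lo)) tT => //; last exact: range_diff.
- by move=> y s sT; rewrite equ.
- by move=> y s sT; rewrite eqv'.
- by move=> y; rewrite u0 v0.
Qed.
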